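(* Let $C:=2\int_0^{1/2}\sin(\log x)\,dx$ and let $\mu^{(1)}$ be the permuton on $[0,1]^2$ with density $$f(x,y)=\begin{cases}1+\sin(\log x)&\text{if }(x,y)\in(0,1/2)\times(0,1/2),\\ 1-\sin(\log x)&\text{if }(x,y)\in(0,1/2)\times(1/2,1),\\ 1-C&\text{if }(x,y)\in(1/2,1)\times(0,1/2),\\ 1+C&\text{if }(x,y)\in(1/2,1)\times(1/2,1).\end{cases}$$ Then the probability measures $\frac1x\,\mu^{(1)}\big([0,x]\times\cdot\big)$ on $[0,1]$ do not converge weakly as $x\to0^+$.
   Context: A permuton is a probability measure on $[0,1]^2$ whose two marginals are uniform on $[0,1]$. *)

(* Defs.v *)
From HB Require Import structures.
From mathcomp Require Import all_boot all_order all_algebra.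
From mathcomp Require Import all_classical all_reals all_analysis.

Set Implicit Arguments.
Unset Strict Implicit.
Unset Printing Implicit Defensive.

Import Order.TTheory GRing.Theory Num.Theory.
Import numFieldNormedType.Exports.

Local Open Scope classical_set_scope.
Local Open Scope ring_scope.

(* Borel measures on [0,1] and [0,1]^2 are represented by Borel measures on R
   and R^2 giving full mass to [0,1], resp. [0,1]^2. *)
Definition is_permuton (R : realType)
    (mu : probability (measurableTypeR R * measurableTypeR R)%type R) : Prop :=
  [/\ mu (`[0, 1] `*` `[0, 1]) = 1%E,
      forall A : set (measurableTypeR R), measurable A ->
        pushforward mu fst A = uniform_prob (@ltr01 R) A &
      forall A : set (measurableTypeR R), measurable A ->
        pushforward mu snd A = uniform_prob (@ltr01 R) A].

Definition has_density (R : realType)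
    (mu : probability (measurableTypeR R * measurableTypeR R)%type R)
    (f : R * R -> R) : Prop :=
  forall A : set (measurableTypeR R * measurableTypeR R), measurable A ->
    mu A = (\int[lebesgue_measure \x lebesgue_measure]_(z in A) (f z)%:E)%E.

Definition sinlogC (R : realType) : R :=
  2 * \int[lebesgue_measure]_(x in `]0, 2^-1[) sin (ln x).

Definition sinlog_density (R : realType) (z : R * R) : R :=
  let: (x, y) := z in
  if (0 < x < 2^-1) && (0 < y < 2^-1) then 1 + sin (ln x)
  else if (0 < x < 2^-1) && (2^-1 < y < 1) then 1 - sin (ln x)
  else if (2^-1 < x < 1) && (0 < y < 2^-1) then 1 - sinlogC R
  else if (2^-1 < x < 1) && (2^-1 < y < 1) then 1 + sinlogC R
  else 0.

Section slice.
Context (R : realType).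
Variable mu : probability (measurableTypeR R * measurableTypeR R)%type R.
Variable x : R.

Definition slice (B : set (measurableTypeR R)) : \bar R :=
  ((x^-1)%:E * mu (`[0%R, x] `*` B))%E.

Let slice0 : slice set0 = 0%E.
Proof. by rewrite /slice setX0 measure0 mule0. Qed.

(* For x < 0 the interval [0, x] is empty, so slice is a measure for all x. *)
Let slice_ge0 B : (0 <= slice B)%E.
Proof.
rewrite /slice; have [x0|x0] := leP 0 x.
  by rewrite mule_ge0// lee_fin invr_ge0.
by rewrite set_itv_ge ?bnd_simp -?ltNge// set0X measure0 mule0.
Qed.

Let slice_sigma_additive : semi_sigma_additive slice.
Proof.
move=> F mF tF mUF; rewrite /slice setX_bigcupr.
have mXF i : measurable (`[0, x] `*` F i :
    set (measurableTypeR R * measurableTypeR R)) by exact: measurableX.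
rewrite [X in X @ \oo --> _](_ : _ = (fun n =>
    (x^-1)%:E * \sum_(0 <= i < n) mu (`[0%R, x] `*` F i))%E); last first.
  apply/funext => n; elim: n => [|n IH]; first by rewrite !big_geq// mule0.
  by rewrite !big_nat_recr//= IH -ge0_muleDr// sume_ge0.
apply: cvgeZl => //; apply: measure_semi_sigma_additive => //.
- apply/trivIsetP => i j _ _ ij; rewrite -setXI setIid.
  by move/trivIsetP : tF => /(_ i j Logic.I Logic.I ij) ->; rewrite setX0.
exact: bigcup_measurable.
Qed.

HB.instance Definition _ := isMeasure.Build _ _ _ slice
  slice0 slice_ge0 slice_sigma_additive.

End slice.

Lemma slice_prob01 (R : realType)
    (mu : probability (measurableTypeR R * measurableTypeR R)%type R) (x : R) :
  is_permuton mu -> 0 < x <= 1 ->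
  slice mu x setT = 1%E /\ slice mu x `[0, 1] = 1%E.
Proof.
move=> [mu01 mu1 mu2] /andP[x0 x1].
have muxT : mu (`[0, x] `*` setT) = x%:E.
  have -> : `[0, x] `*` setT = fst @^-1` `[0, x] :> set (R * R).
    by apply/seteqP; split=> -[a b] /=; tauto.
  have := mu1 `[0, x]%classic (measurable_itv _); rewrite /pushforward => ->.
  rewrite /uniform_prob (eq_integral (cst 1%E)).
    by rewrite integral_cst//= mul1e lebesgue_measure_itv/= lte_fin x0 sube0.
  move=> y; rewrite inE/= in_itv/= => /andP[y0 yx].
  by rewrite /uniform_pdf y0 (le_trans yx x1) subr0 invr1.
have sliceT : slice mu x setT = 1%E.
  by rewrite /slice muxT -EFinM mulVf// gt_eqF.
pose I : set (measurableTypeR R) := `[0, 1]%classic.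
have mI : measurable I by exact: measurable_itv.
split => //; rewrite -/I -sliceT -(setvU I).
rewrite measureU ?setICl//; last exact: measurableC.
rewrite [X in (X + _)%E](_ : _ = 0%E) ?add0e//.
have mS : measurable (I `*` I) by exact: measurableX.
have muS0 : mu (~` (I `*` I)) = 0%E.
  by rewrite probability_setC// mu01 subee.
rewrite /= /slice (_ : mu _ = 0%E) ?mule0//.
apply: subset_measure0 muS0 => //.
- by apply: measurableX => //; exact: measurableC.
- exact: measurableC.
- by move=> [a b] /= [_ h] [_ /h].
Qed.

Definition weakly_cvg01 (R : realType) (T : Type) (F : set_system T)
    (nu_ : T -> {measure set (measurableTypeR R) -> \bar R})
    (nu : {measure set (measurableTypeR R) -> \bar R}) : Prop :=
  forall g : R -> R, {within `[0, 1], continuous g} ->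
    (\int[nu_ t]_(y in `[0%R, 1%R]) (g y)%:E)%E @[t --> F] -->
    (\int[nu]_(y in `[0%R, 1%R]) (g y)%:E)%E.

(* Main.v *)
(* The density has the form a(x) u(y) + b(x) v(y), with u and v the indicators
   of the two halves of the unit interval, so by Tonelli the measure [mu] of a
   rectangle is explicit: (1/x) mu([0, x] * [0, c]) = (1 + m(x)) c for
   x, c < 1/2, where m(x) = (sin (ln x) - cos (ln x)) / 2 is the average of
   sin o ln over [0, x].
   Take a continuous cutoff g between the indicators of [0, 1/8] and [0, 1/4].
   Along ln x = pi - 2 pi n one has m = 1/2, and the integral of g is at least
   3/16 > 1/6; along ln x = - 2 pi n one has m = -1/2, and the integral is at
   most 1/8 < 1/7. Hence these integrals have no limit as x tends to 0. *)
From HB Require Import structures.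
From mathcomp Require Import all_boot all_order all_algebra.
From mathcomp Require Import ring lra.
From mathcomp Require Import all_classical all_reals all_analysis.
From mathcomp Require Import measurable_realfun.
Require Import Defs.

Import Order.TTheory GRing.Theory Num.Theory.
Import numFieldNormedType.Exports.

Local Open Scope classical_set_scope.
Local Open Scope ring_scope.

(** * The integral of sin o ln over ]0, x] *)

Section sin_ln.
Context {R : realType}.
Local Notation leb := (@lebesgue_measure R).
Implicit Types x y e : R.

Lemma measurable_sin_ln (A : set R) :
  measurable_fun A (fun x : R => sin (ln x)).
Proof.
apply: measurable_funTS; apply: measurableT_comp.
  by apply: continuous_measurable_fun; exact: continuous_sin.
exact: measurable_ln.
Qed.

Lemma integrable_sin_ln (i : interval R) : (leb [set` i] < +oo)%E ->
  leb.-integrable [set` i] (EFin \o (fun x => sin (ln x))).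
Proof.
move=> ifin; apply: measurable_bounded_integrable => //.
  exact: measurable_sin_ln.
exists 1; split=> [|M M1 x _]; first exact: num_real.
exact: le_trans (sin_max _) (ltW M1).
Qed.

(** The antiderivative obtained by integrating sin o ln by parts twice. *)
Definition sin_ln_prim x := x * (sin (ln x) - cos (ln x)) / 2.

Lemma is_derive_sin_ln_prim x : 0 < x ->
  is_derive x 1 sin_ln_prim (sin (ln x)).
Proof.
move=> x0; have ? := is_derive1_ln x0.
rewrite /sin_ln_prim; apply: is_derive_eq.
rewrite /GRing.scale/=; field; lra.
Qed.

Lemma Rintegral_sin_ln_cc e x : 0 < e < x ->
  \int[leb]_(t in `[e, x]) sin (ln t) = sin_ln_prim x - sin_ln_prim e.
Proof.
move=> /andP[e0 ex].
have dF y : e <= y -> is_derive y 1 sin_ln_prim (sin (ln y)).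
  by move=> ey; apply: is_derive_sin_ln_prim; exact: lt_le_trans ey.
have cF y : e <= y -> {for y, continuous sin_ln_prim}.
  move=> ey; apply/differentiable_continuous/derivable1_diffP.
  by have [] := dF _ ey.
rewrite /Rintegral (@continuous_FTC2 _ _ sin_ln_prim)//.
- apply: continuous_in_subspaceT => y; rewrite inE/= in_itv/= => /andP[ey _].
  apply: continuous_comp; last exact: continuous_sin.
  by apply: continuous_ln; exact: lt_le_trans ey.
- split.
  + by move=> y; rewrite in_itv/= => /andP[/ltW /dF[]].
  + by apply: cvg_at_right_filter; exact: cF.
  + by apply: cvg_at_left_filter; apply: cF; exact: ltW.
- move=> y; rewrite in_itv/= => /andP[/ltW ey _].
  by rewrite derive1E; exact: (@derive_val _ _ _ _ _ _ _ (dF _ ey)).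
Qed.

Lemma norm_sin_ln_prim x : 0 <= x -> `|sin_ln_prim x| <= x.
Proof.
move=> x0; rewrite /sin_ln_prim normrM (gtr0_norm (_ : 0 < 2^-1))//.
rewrite normrM (ger0_norm x0).
have := ler_normB (sin (ln x)) (cos (ln x)).
have := sin_max (ln x); have := cos_max (ln x) => h1 h2 h3.
have : `|sin (ln x) - cos (ln x)| <= 2 by lra.
by move=> h; rewrite ler_pdivrMr// ler_wpM2l.
Qed.

Lemma norm_Rintegral_sin_ln e : 0 < e ->
  `|\int[leb]_(t in `]0, e]) sin (ln t)| <= e.
Proof.
move=> e0; have ifin : (leb `]0%R, e]%classic < +oo)%E.
  by rewrite lebesgue_measure_itv/= lte_fin e0 sube0 ltry.
apply: le_trans (le_normr_Rintegral _ _) _ => //.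
  exact: integrable_sin_ln.
apply: (@le_trans _ _ (\int[leb]_(t in `]0, e]) 1)).
  apply: le_Rintegral => //.
  - by apply: integrable_norm; exact: integrable_sin_ln.
  - apply: measurable_bounded_integrable => //.
    by exists 1; split=> [|M M1 t _]; rewrite ?num_real// normr1 ltW.
  - by move=> t _; exact: sin_max.
by rewrite Rintegral_cst// mul1r/= lebesgue_measure_itv/= lte_fin e0 sube0.
Qed.

(** Since sin o ln oscillates at 0, the fundamental theorem is applied on [d, x] with d > 0 only.
    The two errors, [sin_ln_prim d] and the integral over ]0, d], are each at most d in absolute
    value, and d is arbitrarily small. *)
Lemma Rintegral_sin_ln x : 0 < x ->
  \int[leb]_(t in `]0, x]) sin (ln t) = x * (sin (ln x) - cos (ln x)) / 2.
Proof.
move=> x0; rewrite -/(sin_ln_prim x); apply/eqP; rewrite -subr_eq0 -normr_le0.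
apply/ler_addgt0Pr => e e0; rewrite add0r.
(* The bound by e / 2 lets the two errors of size d add up to at most e; the bound by x / 2 puts d
   inside ]0, x[. *)
pose d := Num.min (e / 2) (x / 2).
have d0 : 0 < d by rewrite /d lt_min; apply/andP; split; lra.
have dx : d < x by rewrite /d gt_min; apply/orP; right; lra.
have de : d * 2 <= e by rewrite -ler_pdivlMr// /d ge_min lexx.
have int0x : leb.-integrable `]0, x] (EFin \o (fun x => sin (ln x))).
  apply: integrable_sin_ln.
  by rewrite lebesgue_measure_itv/= lte_fin x0 sube0 ltry.
have := @Rintegral_itvB _ (fun x => sin (ln x)) (BRight 0) (BRight x) d int0x.
rewrite !bnd_simp => /(_ (ltW d0) (ltW dx)) /eqP; rewrite subr_eq => /eqP ->.
rewrite Rintegral_itv_obnd_cbnd; last first.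
  apply: integrable_sin_ln.
  by rewrite lebesgue_measure_itv/= lte_fin dx -EFinB ltry.
rewrite Rintegral_sin_ln_cc ?d0//.
have h1 := norm_sin_ln_prim _ (ltW d0).
have h2 := norm_Rintegral_sin_ln _ d0.
move: h1 h2; rewrite !ler_norml => /andP[? ?] /andP[? ?].
by apply/andP; split; lra.
Qed.

End sin_ln.

(** * Tonelli for a product function on a rectangle *)

Section product_integral.
Context d1 d2 (T1 : measurableType d1) (T2 : measurableType d2) (R : realType).
Variable m1 : {sigma_finite_measure set T1 -> \bar R}.
Variable m2 : {sigma_finite_measure set T2 -> \bar R}.
Variables (f : T1 -> R) (g : T2 -> R).
Hypotheses (mf : measurable_fun setT f) (mg : measurable_fun setT g).
Hypotheses (f0 : forall x, 0 <= f x) (g0 : forall y, 0 <= g y).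

(** The indicator of a rectangle is itself a product, so extending both factors by 0 reduces to
    Tonelli on the whole space, where constants come out of each integral. *)
Lemma ge0_integral_setX_mul A B : measurable A -> measurable B ->
  (\int[m1 \x m2]_(z in A `*` B) (f z.1 * g z.2)%:E =
   (\int[m1]_(x in A) (f x)%:E) * (\int[m2]_(y in B) (g y)%:E))%E.
Proof.
move=> mA mB.
have mfA : measurable_fun setT (f \_ A).
  by apply/(measurable_restrictT _ _).1 => //; exact: measurable_funTS.
have mgB : measurable_fun setT (g \_ B).
  by apply/(measurable_restrictT _ _).1 => //; exact: measurable_funTS.
have fA0 x : 0 <= (f \_ A) x by rewrite patchE; case: ifP.
have gB0 y : 0 <= (g \_ B) y by rewrite patchE; case: ifP.
rewrite integral_mkcond.
transitivity (\int[m1 \x m2]_z ((f \_ A) z.1 * (g \_ B) z.2)%:E)%E.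
  apply: eq_integral => -[x y] _; rewrite !patchE/= in_setX.
  by case: (x \in A); case: (y \in B); rewrite ?mulr0 ?mul0r.
rewrite fubini_tonelli1/=; last 2 first.
- apply/measurable_EFinP; apply: measurable_funM.
    by apply: measurableT_comp mfA _.
  by apply: measurableT_comp mgB _.
- by move=> z; rewrite lee_fin mulr_ge0.
rewrite [in RHS]integral_mkcond [X in (_ * X)%E]integral_mkcond !restrict_EFin.
rewrite -ge0_integralZr//; last 3 first.
- exact/measurable_EFinP.
- by move=> x _; rewrite lee_fin.
- by apply: integral_ge0 => y _; rewrite lee_fin.
apply: eq_integral => x _; rewrite /fubini_F/=.
under eq_integral do rewrite EFinM.
rewrite ge0_integralZl ?lee_fin//; first exact/measurable_EFinP.
by move=> y _; rewrite lee_fin.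
Qed.

End product_integral.

(** * The density and its integrals over rectangles *)

Section sinlog_permuton.
Context {R : realType}.
Local Notation T := (measurableTypeR R).
Local Notation leb := (@lebesgue_measure R).
Local Notation C := (sinlogC R).
Local Notation lo := (`]0%R, 2^-1%R[%classic : set T).
Local Notation hi := (`]2^-1%R, 1%R[%classic : set T).
Implicit Types (A B : set T) (k : R).

(** Twice an integral of a function bounded by 1 over an interval of length 1/2. This makes the
    values 1 - C and 1 + C of the density nonnegative. *)
Lemma norm_sinlogC : `|C| <= 1.
Proof.
have h0 : 0 < 2^-1 :> R by lra.
rewrite /sinlogC Rintegral_itv_bndo_bndc.
  by have := norm_Rintegral_sin_ln _ h0; rewrite !ler_norml; lra.
apply: integrable_sin_ln.
by rewrite lebesgue_measure_itv/= lte_fin h0 sube0 ltry.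
Qed.

(* [slice_density 1] and [slice_density (-1)] are the values of the density on
   the lower and upper halves of the square, as functions of the abscissa. *)
Definition slice_density k (x : R) :=
  (1 + k * sin (ln x)) * \1_lo x + (1 - k * C) * \1_hi x.

Lemma sinlog_densityE (z : R * R) : sinlog_density z =
  slice_density 1 z.1 * \1_lo z.2 + slice_density (-1) z.1 * \1_hi z.2.
Proof.
case: z => x y; rewrite /sinlog_density /slice_density/= !indicE !mem_setE/=.
rewrite !in_itv/=.
have dj (t : R) : (0 < t < 2^-1) && (2^-1 < t < 1) = false.
  by apply/negbTE/negP => /andP[]; lra.
move: (dj x) (dj y).
case: (0 < x < 2^-1); case: (2^-1 < x < 1) => //= _;
case: (0 < y < 2^-1); case: (2^-1 < y < 1) => //= _; ring.
Qed.

Lemma ge0_1D_sin k x : `|k| <= 1 -> 0 <= 1 + k * sin (ln x).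
Proof.
move=> k1; have : `|k * sin (ln x)| <= 1 by rewrite normrM mulr_ile1// sin_max.
by rewrite ler_norml; lra.
Qed.

Lemma ge0_1B_sinlogC k : `|k| <= 1 -> 0 <= 1 - k * C.
Proof.
move=> k1; have : `|k * C| <= 1 by rewrite normrM mulr_ile1// norm_sinlogC.
by rewrite ler_norml; lra.
Qed.

Lemma slice_density_ge0 k x : `|k| <= 1 -> 0 <= slice_density k x.
Proof.
move=> k1; rewrite /slice_density addr_ge0// mulr_ge0//.
  exact: ge0_1D_sin.
exact: ge0_1B_sinlogC.
Qed.

Lemma measurable_slice_density k (A : set T) :
  measurable_fun A (slice_density k).
Proof.
apply: measurable_funTS; apply: measurable_funD; apply: measurable_funM => //.
apply: measurable_funD => //; apply: measurable_funM => //.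
exact: measurable_sin_ln.
Qed.

Lemma measurable_slice_densityM k A : measurable A ->
  measurable_fun setT (fun z : T * T => slice_density k z.1 * \1_A z.2).
Proof.
move=> mA; apply: measurable_funM.
  by apply: measurableT_comp (measurable_slice_density k setT) _.
by apply: (@measurableT_comp _ _ _ _ _ _ (\1_A : T -> R) _ snd).
Qed.

(** The bound on k makes both summands of [slice_density] nonnegative, so the integral splits for
    every measurable A, of finite measure or not. *)
Lemma integral_slice_density k A : `|k| <= 1 -> measurable A ->
  (\int[leb]_(x in A) (slice_density k x)%:E =
   \int[leb]_(x in A `&` lo) (1 + k * sin (ln x))%:E
   + (1 - k * C)%:E * leb (A `&` hi))%E.
Proof.
move=> k1 mA; under eq_integral do rewrite EFinD.
rewrite ge0_integralD//; last 4 first.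
- by move=> x _; rewrite lee_fin mulr_ge0// ge0_1D_sin.
- apply/measurable_EFinP; apply: measurable_funM => //.
  apply: measurable_funD => //; apply: measurable_funM => //.
  exact: measurable_sin_ln.
- by move=> x _; rewrite lee_fin mulr_ge0// ge0_1B_sinlogC.
- by apply/measurable_EFinP; exact: measurable_funM.
congr (_ + _)%E.
  rewrite integral_mkcondr; apply: eq_integral => x _.
  by rewrite patchE indicE; case: ifP => _; rewrite ?mulr1 ?mulr0.
under eq_integral do rewrite EFinM.
rewrite ge0_integralZl ?lee_fin ?ge0_1B_sinlogC//; last exact/measurable_EFinP.
by rewrite integral_indic// setIC.
Qed.

Lemma integral_sinlog_density A B : measurable A -> measurable B ->
  (\int[leb \x leb]_(z in A `*` B) (sinlog_density z)%:E =
   \int[leb]_(x in A) (slice_density 1 x)%:E * leb (B `&` lo)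
   + \int[leb]_(x in A) (slice_density (-1) x)%:E * leb (B `&` hi))%E.
Proof.
move=> mA mB; have n1 : `|1| <= 1 :> R by rewrite normr1.
have nN1 : `|-1| <= 1 :> R by rewrite normrN1.
under eq_integral do rewrite sinlog_densityE EFinD.
rewrite ge0_integralD//; last 5 first.
- exact: measurableX.
- by move=> z _; rewrite lee_fin mulr_ge0// slice_density_ge0.
- apply: measurable_funTS; apply/measurable_EFinP.
  exact: measurable_slice_densityM.
- by move=> z _; rewrite lee_fin mulr_ge0// slice_density_ge0.
- apply: measurable_funTS; apply/measurable_EFinP.
  exact: measurable_slice_densityM.
rewrite !ge0_integral_setX_mul//; do ?[exact: measurable_slice_density
  | by move=> x; exact: slice_density_ge0].
by rewrite !integral_indic// ![_ `&` B]setIC.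
Qed.

Lemma lebesgue_lo : leb lo = (2^-1)%:E.
Proof. by rewrite lebesgue_measure_itv/= lte_fin sube0 ifT//; lra. Qed.

Lemma lebesgue_hi : leb hi = (2^-1)%:E.
Proof.
rewrite lebesgue_measure_itv/= lte_fin ifT; last lra.
by rewrite -EFinB; congr EFin; lra.
Qed.

Lemma integral_1D_sin k x : 0 < x ->
  (\int[leb]_(t in `]0%R, x]) (1 + k * sin (ln t))%:E =
   (x + k * \int[leb]_(t in `]0, x]) sin (ln t))%:E)%E.
Proof.
move=> x0; have lebx : leb `]0%R, x]%classic = x%:E.
  by rewrite lebesgue_measure_itv/= lte_fin x0 sube0.
have isin : leb.-integrable `]0, x] (EFin \o (fun t => sin (ln t))).
  by apply: integrable_sin_ln; rewrite lebx ltry.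
have i1 : leb.-integrable `]0, x] (EFin \o (fun _ : R => 1 : R)).
  apply: measurable_bounded_integrable => //; first by rewrite /= lebx ltry.
  exact: bounded_cst.
under eq_integral do rewrite EFinD EFinM.
rewrite integralD//=; last first.
  by apply: integrableZl.
rewrite integral_cst//= lebx mul1e integralZl// EFinD EFinM.
by congr (_ + _ * _)%E; rewrite /Rintegral fineK//; exact: integrable_fin_num.
Qed.

Lemma integral_slice_density_itv k x : `|k| <= 1 -> 0 < x < 2^-1 ->
  (\int[leb]_(t in `[0%R, x]) (slice_density k t)%:E =
   (x + k * (x * (sin (ln x) - cos (ln x)) / 2))%:E)%E.
Proof.
move=> k1 /andP[x0 x1]; rewrite integral_slice_density//.
rewrite [X in leb X](_ : _ = set0) ?measure0 ?mule0 ?adde0; last first.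
  by apply/seteqP; split=> // t [] /=; rewrite !in_itv/=; lra.
rewrite [X in integral _ X](_ : _ = `]0%R, x]%classic); last first.
  by apply/seteqP; split=> t; rewrite /= !in_itv/= ; [case|]; lra.
by rewrite integral_1D_sin// Rintegral_sin_ln.
Qed.

(** This is what the constant C is for: the left half contributes 1/2 + k C / 2 and the right half
    (1 - k C) / 2. It yields the second marginal with A the whole line, and the mass of the square
    with A = [0, 1]. *)
Lemma integral_slice_density1 k A : `|k| <= 1 -> measurable A ->
  `]0%R, 1%R[ `<=` A -> (\int[leb]_(t in A) (slice_density k t)%:E = 1)%E.
Proof.
move=> k1 mA A01; have h0 : 0 < 2^-1 :> R by lra.
have Alo : A `&` lo = lo.
  rewrite setIidr// => t /=; rewrite in_itv/= => t0.
  by apply: A01 => /=; rewrite in_itv/=; lra.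
have Ahi : A `&` hi = hi.
  rewrite setIidr// => t /=; rewrite in_itv/= => t0.
  by apply: A01 => /=; rewrite in_itv/=; lra.
rewrite integral_slice_density// Alo Ahi lebesgue_hi.
rewrite integral_itv_bndo_bndc; last first.
  apply/measurable_EFinP; apply: measurable_funD => //.
  apply: measurable_funM => //; exact: measurable_sin_ln.
rewrite integral_1D_sin// -Rintegral_itv_bndo_bndc; last first.
  apply: integrable_sin_ln.
  by rewrite lebesgue_measure_itv/= lte_fin h0 sube0 ltry.
by rewrite -EFinM -EFinD /sinlogC; congr EFin; lra.
Qed.

(** The uniform density and the sum of the indicators of the two open halves differ at most at the
    points 0, 1/2 and 1, which form the null set [N]. *)
Lemma uniform_probE A : measurable A ->
  (uniform_prob (@ltr01 R) A = leb (A `&` lo) + leb (A `&` hi))%E.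
Proof.
move=> mA; pose N : set T := [set 0; 2^-1; 1].
have mN : measurable N by do 2 apply: measurableU => //.
have N0 : leb N = 0%E.
  apply: countable_lebesgue_measure0; apply: finite_set_countable.
  by rewrite /N !finite_setU; do !split; exact: finite_set1.
rewrite /uniform_prob (ge0_negligible_integral mN)//; last 2 first.
- apply: measurable_funTS; apply/measurable_EFinP.
  exact: measurable_uniform_pdf.
- by move=> x _; rewrite lee_fin uniform_pdf_ge0.
have -> : (leb (A `&` lo) + leb (A `&` hi) =
    \int[leb]_(x in A) ((\1_lo x)%:E + (\1_hi x)%:E))%E.
  rewrite ge0_integralD//; try exact/measurable_EFinP.
  by rewrite !integral_indic// ![_ `&` A]setIC.
rewrite [RHS](ge0_negligible_integral mN)//; last 2 first.
- by apply: emeasurable_funD; exact/measurable_EFinP.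
- by move=> x _; rewrite adde_ge0.
apply: eq_integral => x; rewrite inE => -[_ xN].
(* Off [N] every comparison of x with 0, 1/2 and 1 is strict; the inconsistent orderings are
   discarded and both densities are computed in the others. *)
have [x0 xh x1] : [/\ x != 0, x != 2^-1 & x != 1].
  by split; apply/eqP => xE; apply: xN; rewrite /N/= xE; tauto.
rewrite /uniform_pdf !indicE !mem_setE/= !in_itv/= subr0 invr1.
rewrite -EFinD; congr EFin; move: x0 xh x1; rewrite !neq_lt.
move=> /orP[]x0 /orP[]xh /orP[]x1; try lra;
  rewrite ?x0 ?xh ?x1 ?(ltW x0) ?(ltW x1);
  rewrite ?(lt_gtF x0) ?(lt_gtF xh) ?(lt_gtF x1);
  rewrite ?(lt_geF x0) ?(lt_geF x1) ?andbF/= ?addr0 ?add0r//.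
Qed.

(** * Uniform marginals *)

Section marginals.
(** Only a measure is assumed, because [sinlog_fst] is later used to prove that [sinlog_measure] has
    total mass 1. *)
Variable mu : {measure set (T * T) -> \bar R}.
Hypothesis mu_density : forall D : set (T * T), measurable D ->
  mu D = (\int[leb \x leb]_(z in D) (sinlog_density z)%:E)%E.

Lemma sinlog_fst A : measurable A ->
  mu (A `*` setT) = uniform_prob (@ltr01 R) A.
Proof.
move=> mA; rewrite mu_density ?integral_sinlog_density//; last first.
  exact: measurableX.
have sd0 x : (0 <= (slice_density 1 x)%:E)%E.
  by rewrite lee_fin slice_density_ge0 ?normr1.
have sdN0 x : (0 <= (slice_density (-1) x)%:E)%E.
  by rewrite lee_fin slice_density_ge0 ?normrN1.
have msd k : measurable_fun A (EFin \o slice_density k).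
  by apply/measurable_EFinP; exact: measurable_slice_density.
rewrite !setTI lebesgue_lo lebesgue_hi uniform_probE//.
rewrite -ge0_muleDl; [|by apply: integral_ge0 => x _..].
rewrite -ge0_integralD//; [|exact: msd..].
rewrite -ge0_integralZr//=; last 2 first.
- by apply: emeasurable_funD; exact: msd.
- by move=> x _; rewrite adde_ge0.
(* The terms in k cancel between k = 1 and k = -1: the two slice densities add up to 2 on each half,
   and each carries the weight 1/2. *)
transitivity (\int[leb]_(x in A) ((\1_lo x)%:E + (\1_hi x)%:E))%E.
  apply: eq_integral => x _; rewrite -EFinD -EFinM -EFinD; congr EFin.
  by rewrite /slice_density; field.
rewrite ge0_integralD//; try exact/measurable_EFinP.
by rewrite !integral_indic// ![_ `&` A]setIC.
Qed.

(** Both slice densities have total integral 1, so only the lengths of the two parts of B remain. *)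
Lemma sinlog_snd B : measurable B ->
  mu (setT `*` B) = uniform_prob (@ltr01 R) B.
Proof.
move=> mB; rewrite mu_density ?integral_sinlog_density//; last first.
  exact: measurableX.
by rewrite !integral_slice_density1 ?normrN1 ?normr1// !mul1e uniform_probE.
Qed.

Lemma sinlog_unit_square : mu (`[0%R, 1%R] `*` `[0%R, 1%R]) = 1%E.
Proof.
rewrite mu_density ?integral_sinlog_density//; last first.
  exact: measurableX.
have oc01 : `]0%R, 1%R[ `<=` (`[0%R, 1%R]%classic : set T).
  by apply: subset_itvScc; rewrite bnd_simp.
rewrite !integral_slice_density1 ?normrN1 ?normr1// !mul1e.
by rewrite -uniform_probE// /uniform_prob integral_uniform_pdf1.
Qed.

End marginals.

(** * Existence of the permuton *)

Definition sinlog_measure (D : set (T * T)) : \bar R :=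
  (\int[leb \x leb]_(z in D) (sinlog_density z)%:E)%E.

Lemma sinlog_density_ge0 z : 0 <= @sinlog_density R z.
Proof.
by rewrite sinlog_densityE addr_ge0// mulr_ge0// slice_density_ge0//
  ?normrN1 ?normr1.
Qed.

Lemma measurable_sinlog_density :
  measurable_fun setT (@sinlog_density R : T * T -> R).
Proof.
rewrite (_ : @sinlog_density R =
    (fun z : T * T => slice_density 1 z.1 * \1_lo z.2)
    \+ (fun z : T * T => slice_density (-1) z.1 * \1_hi z.2)).
  by apply: measurable_funD; exact: measurable_slice_densityM.
by apply/funext => z; exact: sinlog_densityE.
Qed.

Let sinlog_measure0 : sinlog_measure set0 = 0%E.
Proof. exact: integral_set0. Qed.

Let sinlog_measure_ge0 D : (0 <= sinlog_measure D)%E.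
Proof. by apply: integral_ge0 => z _; rewrite lee_fin sinlog_density_ge0. Qed.

Let sinlog_measure_sigma_additive : semi_sigma_additive sinlog_measure.
Proof.
apply: semi_sigma_additive_nng_induced => [|z].
  by apply/measurable_EFinP; exact: measurable_sinlog_density.
by rewrite lee_fin sinlog_density_ge0.
Qed.

HB.instance Definition _ := isMeasure.Build _ _ _ sinlog_measure
  sinlog_measure0 sinlog_measure_ge0 sinlog_measure_sigma_additive.

Let sinlog_measureT : sinlog_measure setT = 1%E.
Proof.
rewrite -setXTT (@sinlog_fst sinlog_measure)//.
exact: integral_uniform_pdf1.
Qed.

HB.instance Definition _ :=
  Measure_isProbability.Build _ _ _ sinlog_measure sinlog_measureT.

Lemma sinlog_permuton_exists : exists mu : probability (T * T)%type R,
  is_permuton mu /\ has_density mu (@sinlog_density R).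
Proof.
exists sinlog_measure; split=> //; split=> [|A mA|A mA].
- exact: sinlog_unit_square.
- rewrite -(@sinlog_fst sinlog_measure)// /pushforward; congr (_ _).
  by apply/seteqP; split=> -[a b] /=; tauto.
- rewrite -(@sinlog_snd sinlog_measure)// /pushforward; congr (_ _).
  by apply/seteqP; split=> -[a b] /=; tauto.
Qed.

(** * Slices evaluated on initial intervals *)

Lemma slice_itv (mu : probability (T * T)%type R) x c :
  has_density mu (@sinlog_density R) -> 0 < x < 2^-1 -> 0 < c < 2^-1 ->
  (slice mu x `[0%R, c] = ((1 + (sin (ln x) - cos (ln x)) / 2) * c)%:E)%E.
Proof.
move=> mud x01 /andP[c0 c1]; have x0 : 0 < x by case/andP: x01.
rewrite /slice/= mud; last by apply: measurableX; exact: measurable_itv.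
rewrite integral_sinlog_density// integral_slice_density_itv ?normr1//.
rewrite [X in leb X](_ : _ = `]0%R, c]%classic); last first.
  by apply/seteqP; split=> t; rewrite /= !in_itv/= ; [case|]; lra.
rewrite [X in (_ + _ * leb X)%E](_ : _ = set0); last first.
  by apply/seteqP; split=> // t [] /=; rewrite !in_itv/=; lra.
rewrite measure0 mule0 adde0 lebesgue_measure_itv/= lte_fin c0 sube0 -!EFinM.
by congr EFin; field; rewrite gt_eqF.
Qed.

End sinlog_permuton.

(** * The continuous test function *)

Section cutoff.
Context {R : realType}.
Local Notation T := (measurableTypeR R).

(** The affine function with value 1 at 1/8 and 0 at 1/4, clamped to [0, 1]. *)
Definition cutoff : R -> R := cst 0 \max (cst 1 \min (fun y => 2 - 8 * y)).

Lemma continuous_cutoff : continuous cutoff.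
Proof.
move=> y; apply: continuous_max; first exact: cvg_cst.
apply: continuous_min; first exact: cvg_cst.
by apply: cvgB; [exact: cvg_cst|apply: cvgM; [exact: cvg_cst|exact: cvg_id]].
Qed.

(** On [0, 1] the cutoff lies between the indicators of [0, 1/8] and [0, 1/4]. Integrals of [cutoff]
    are thus compared with masses of intervals, which [slice_itv] computes. *)
Lemma integral_cutoff_bounds (nu : {measure set T -> \bar R}) :
  (nu `[0%R, 8^-1%R]%classic <= \int[nu]_(y in `[0%R, 1%R]) (cutoff y)%:E
     <= nu `[0%R, 4^-1%R]%classic)%E.
Proof.
have mc (D : set T) : measurable_fun D (EFin \o cutoff).
  apply/measurable_EFinP; apply: measurable_funTS.
  exact: continuous_measurable_fun continuous_cutoff.
have c0 y : 0 <= cutoff y by rewrite /cutoff/= le_max lexx.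
have itvE c : c <= 1 -> (nu `[0%R, c]%classic =
    \int[nu]_(y in `[0%R, 1%R]) (\1_(`[0%R, c]%classic : set T) y)%:E)%E.
  move=> c1; rewrite integral_indic//= setIidl// => y /=.
  by rewrite !in_itv/= => /andP[-> yc]; exact: le_trans yc c1.
rewrite (itvE 8^-1) ?(itvE 4^-1); [|lra..].
apply/andP; split; apply: ge0_le_integral => //=;
  do ?[exact/measurable_EFinP | by move=> y _; rewrite lee_fin ?c0];
  move=> y; rewrite in_itv/= => /andP[y0 y1];
  rewrite lee_fin indicE mem_setE in_itv/= y0/=.
- have [y8|_] := leP y 8^-1; last exact: c0.
  by rewrite /cutoff/= le_max le_min lexx/=; apply/orP; right; lra.
- rewrite /cutoff/= ge_max; have [y4|y4] := leP y 4^-1.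
    by rewrite ler01 ge_min lexx.
  by rewrite mulr0n lexx ge_min; apply/orP; right; lra.
Qed.

End cutoff.

(** The points exp (t - 2 pi n) tend to 0, and their logarithms all have the phase t. *)
Lemma sin_cos_ln_near0 {R : realType} (t d : R) : 0 < d ->
  exists2 x, 0 < x < d & sin (ln x) = sin t /\ cos (ln x) = cos t.
Proof.
move=> d0; have p0 : 0 < pi *+ 2 :> R by rewrite mulrn_wgt0// pi_gt0.
(* Being below d amounts to t - ln d < 2 pi n. *)
pose n := Num.bound `|(t - ln d) / (pi *+ 2)|.
exists (expR (t - pi *+ 2 *+ n)).
  rewrite expR_gt0/= -[ltRHS]lnK// ltr_expR ltrBlDr -ltrBlDl -mulr_natr mulrC.
  rewrite -ltr_pdivrMr//; apply: le_lt_trans (ler_norm _) _.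
  by apply: archi_boundP; exact: normr_ge0.
rewrite expRK; split.
  by rewrite -[LHS](periodicn (@sinD2pi R) n) subrK.
by rewrite -[LHS](periodicn (@cosD2pi R) n) subrK.
Qed.

(** * Existence, and absence of a weak limit *)

Theorem proposition5p3 (R : realType) :
  (exists mu : probability (measurableTypeR R * measurableTypeR R)%type R,
     is_permuton mu /\ has_density mu (@sinlog_density R)) /\
  (forall mu : probability (measurableTypeR R * measurableTypeR R)%type R,
     is_permuton mu -> has_density mu (@sinlog_density R) ->
     ~ exists nu : probability (measurableTypeR R) R,
         nu `[0, 1]%classic = 1%E /\
         weakly_cvg01 (0 : R)^'+ (fun x : R => slice mu x) nu).
Proof.
split; first exact: sinlog_permuton_exists.
move=> mu _ mud [nu [_ /(_ cutoff (continuous_subspaceT continuous_cutoff))]].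
set l := (\int[nu]_(y in _) _)%E => cvgl.
(* Each phase t recurs arbitrarily close to 0, so whatever holds eventually holds at some x of phase
   t; x < 1/2 is kept for [slice_itv]. *)
have frequently t (P : R -> Prop) : (\forall x \near (0 : R)^'+, P x) ->
    exists2 x, 0 < x < 2^-1 & [/\ P x, sin (ln x) = sin t & cos (ln x) = cos t].
  move=> [e/= e0 eP].
  have [|x /andP[x0 xe] [st ct]] := sin_cos_ln_near0 t (Num.min e 2^-1).
    by rewrite lt_min; apply/andP; split=> //; lra.
  move: xe; rewrite lt_min => /andP[xe x2]; exists x; first by rewrite x0.
  by split=> //; apply: eP => //=; rewrite sub0r normrN gtr0_norm.
(* Every extended real l is below 1/6 or above 1/7. The first case fails at phase pi, where the
   integral is at least (1 + 1/2) / 8 = 3/16; the second fails at phase 0, where it is at most (1 -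
   1/2) / 4 = 1/8. *)
have [l6|l6] := ltP l (6^-1)%:E.
- have : \forall x \near (0 : R)^'+,
      (\int[slice mu x]_(y in `[0%R, 1%R]) (cutoff y)%:E < (6^-1)%:E)%E.
    exact: cvgl (open_ereal_lt' l6).
  move=> /(frequently pi)[x x0 [+ st ct]].
  have /andP[+ _] := integral_cutoff_bounds (slice mu x).
  rewrite /= slice_itv//; last lra.
  rewrite st ct sinpi cospi => /le_lt_trans/[apply].
  by rewrite lte_fin; lra.
- have l7 : ((7^-1)%:E < l)%E by apply: lt_le_trans l6; rewrite lte_fin; lra.
  have : \forall x \near (0 : R)^'+,
      ((7^-1)%:E < \int[slice mu x]_(y in `[0%R, 1%R]) (cutoff y)%:E)%E.
    exact: cvgl (open_ereal_gt' l7).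
  move=> /(frequently 0)[x x0 [+ st ct]].
  have /andP[_] := integral_cutoff_bounds (slice mu x).
  rewrite /= slice_itv//; last lra.
  rewrite st ct sin0 cos0 => /[swap] /lt_le_trans/[apply].
  by rewrite lte_fin; lra.
Qed.
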